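(* Let $B$ be an annihilator nilpotent skew brace. If $A$ is a sub skew brace of $B$ such that $A+B^2=B$, then $A=B$.
   Context: A skew brace is a triple $(B,+,\circ)$ where $(B,+)$ and $(B,\circ)$ are (not necessarily abelian) groups such that $a\circ(b+c)=a\circ b-a+a\circ c$ for all $a,b,c\in B$. The two groups share the same identity, denoted $0$. Put $\lambda_a(b)=-a+a\circ b$ and $a*b=-a+a\circ b-b$. A sub skew brace is a subset that is a subgroup of both $(B,+)$ and $(B,\circ)$. An ideal of $B$ is a subset that is a normal subgroup of both $(B,+)$ and $(B,\circ)$ and is mapped into itself by every $\lambda_a$. The annihilator is $\operatorname{Ann}(B)=\{x\in B: x\circ a=a\circ x=x+a=a+x \text{ for all } a\in B\}$, an ideal of $B$. An annihilator series of $B$ is a series of ideals $0=I_0\subseteq I_1\subseteq\cdots\subseteq I_n=B$ with $I_{j+1}/I_j\subseteq\operatorname{Ann}(B/I_j)$ for $0\le j<n$; $B$ is annihilator nilpotent if it has an annihilator series. $B^2=B*B$ denotes the additive subgroup of $B$ generated by $\{x*y:x,y\in B\}$ (it is an ideal of $B$), and $A+B^2=\{a+b:a\in A,\ b\in B^2\}$. *)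

(* Defs.v *)
From HB Require Import structures.
From mathcomp Require Import all_boot.
From mathcomp Require Import boolp classical_sets.

Set Implicit Arguments.
Unset Strict Implicit.
Unset Printing Implicit Defensive.

Local Open Scope classical_set_scope.
Local Open Scope quotient_scope.

Declare Scope skew_brace_scope.
Delimit Scope skew_brace_scope with SB.
Local Open Scope skew_brace_scope.

(* The [groupType] structure of B is the group (B, ∘). The group (B, +) gets its
   own operations, since additive groups in the library ([zmodType]) are commutative. *)
HB.mixin Record isSkewBrace B of Group B := {
  sbzero : B;
  sbopp : B -> B;
  sbadd : B -> B -> B;
  sbaddA : associative sbadd;
  sbadd0r : left_id sbzero sbadd;
  sbaddr0 : right_id sbzero sbadd;
  sbaddNr : left_inverse sbzero sbopp sbadd;
  sbaddrN : right_inverse sbzero sbopp sbadd;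
  sbmulD : forall a b c : B,
    (a * sbadd b c)%g = sbadd (sbadd (a * b)%g (sbopp a)) (a * c)%g
}.

#[short(type="skewBraceType")]
HB.structure Definition SkewBrace := {B of isSkewBrace B & Group B}.

Notation "0" := (@sbzero _) : skew_brace_scope.
Notation "a + b" := (@sbadd _ a b) : skew_brace_scope.
Notation "- a" := (@sbopp _ a) : skew_brace_scope.
Notation "a - b" := (@sbadd _ a (@sbopp _ b)) : skew_brace_scope.
Notation "a ∘ b" := (a * b)%g
  (at level 40, left associativity) : skew_brace_scope.

Definition sblambda (B : skewBraceType) (a b : B) : B := - a + a ∘ b.
Definition sbstar (B : skewBraceType) (a b : B) : B := - a + a ∘ b - b.
Notation "a ⋆ b" := (sbstar a b)
  (at level 40, left associativity) : skew_brace_scope.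

Section Subsets.
Variable B : skewBraceType.
Implicit Types S X Y : set B.

Definition add_subgroup S : Prop :=
  [/\ S 0, forall x y, S x -> S y -> S (x + y) & forall x, S x -> S (- x)].

Definition mul_subgroup S : Prop :=
  [/\ S 1%g, forall x y, S x -> S y -> S (x ∘ y) & forall x, S x -> S x^-1%g].

Definition sub_skew_brace S : Prop := add_subgroup S /\ mul_subgroup S.

Definition add_normal S : Prop :=
  add_subgroup S /\ forall x y, S x -> S (- y + x + y).

Definition mul_normal S : Prop :=
  mul_subgroup S /\ forall x y, S x -> S (y^-1%g ∘ x ∘ y).

Definition is_ideal S : Prop :=
  [/\ add_normal S, mul_normal S & forall a x, S x -> S (sblambda a x)].

Definition Ann : set B :=
  [set x | forall a, [/\ x ∘ a = a ∘ x, a ∘ x = x + a & x + a = a + x]].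

Definition star_set X Y : set B :=
  smallest add_subgroup [set x ⋆ y | x in X & y in Y].

Definition add_set X Y : set B := [set x + y | x in X & y in Y].

Definition sqr_brace : set B := star_set [set: B] [set: B].

End Subsets.

Arguments Ann : clear implicits.
Arguments sqr_brace : clear implicits.

Record ideal (B : skewBraceType) := Ideal {
  ideal_set :> set B;
  idealP : is_ideal ideal_set
}.

Section BasicFacts.
Variable B : skewBraceType.
Implicit Types a b c x y : B.

Lemma sbaddKr a b : - a + (a + b) = b.
Proof. by rewrite sbaddA sbaddNr sbadd0r. Qed.

Lemma sbaddNKr a b : a + (- a + b) = b.
Proof. by rewrite sbaddA sbaddrN sbadd0r. Qed.

Lemma sbaddI a b c : a + b = a + c -> b = c.
Proof. by move=> e; rewrite -(sbaddKr a b) e sbaddKr. Qed.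

Lemma sbopp_uniq a b : a + b = 0 -> b = - a.
Proof. by move=> e; apply: (@sbaddI a); rewrite e sbaddrN. Qed.

Lemma sboppK a : - - a = a.
Proof. by rewrite -(@sbopp_uniq (- a) a) // sbaddNr. Qed.

Lemma sboppD a b : - (a + b) = - b - a.
Proof.
apply: esym; apply: sbopp_uniq.
by rewrite -sbaddA (sbaddA b) sbaddrN sbadd0r sbaddrN.
Qed.

Lemma sbmul0 a : a ∘ 0 = a.
Proof.
have := sbmulD a 0 0; rewrite sbadd0r -sbaddA => e.
have {}e : - a + a ∘ 0 = 0 by apply: (@sbaddI (a ∘ 0)); rewrite -e sbaddr0.
by rewrite -[LHS](sbaddNKr a) e sbaddr0.
Qed.

Lemma sb01 : (0 : B) = 1%g.
Proof. by rewrite -(sbmul0 1%g) mul1g. Qed.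

Lemma sbmulE a b : a ∘ b = a + sblambda a b.
Proof. by rewrite /sblambda sbaddNKr. Qed.

Lemma sblambdaM a b x : sblambda (a ∘ b) x = sblambda a (sblambda b x).
Proof.
rewrite /sblambda sbmulD -mulgA -!sbaddA.
have -> : a ∘ - b = a - (a ∘ b) + a.
  apply: (@sbaddI (a ∘ b - a)); rewrite -sbmulD sbaddrN sbmul0.
  by rewrite -!sbaddA sbaddKr sbaddNKr.
by rewrite -!sbaddA sbaddKr sbaddNKr.
Qed.

Lemma sblambda1 x : sblambda 1%g x = x.
Proof. by rewrite /sblambda mul1g -sb01 -(@sbopp_uniq 0 0) ?sbadd0r. Qed.

End BasicFacts.

(* The quotient skew brace B / I on the additive cosets x + I, which coincide with
   the cosets x ∘ I ([coset_rel_mulP]); operations are taken on representatives. *)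
Section Quotient.
Variables (B : skewBraceType) (I : ideal B).
Implicit Types x y z : B.

Local Notation inI := (ideal_set I).

Definition coset_rel (x y : B) : bool := `[< inI (- x + y) >].

Let I0 : inI 0. Proof. by case: (idealP I) => -[[]]. Qed.
Let ID x y : inI x -> inI y -> inI (x + y).
Proof. by case: (idealP I) => -[[_ + _]] _ _ _; apply. Qed.
Let IN x : inI x -> inI (- x).
Proof. by case: (idealP I) => -[[_ _ +]] _ _ _; apply. Qed.
Let IJ x y : inI x -> inI (- y + x + y).
Proof. by case: (idealP I) => -[_ +] _ _; apply. Qed.
Let IM x y : inI x -> inI y -> inI (x ∘ y).
Proof. by case: (idealP I) => _ [[_ + _]] _ _; apply. Qed.
Let IV x : inI x -> inI x^-1%g.
Proof. by case: (idealP I) => _ [[_ _ +]] _ _; apply. Qed.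
Let IJm x y : inI x -> inI (y^-1%g ∘ x ∘ y).
Proof. by case: (idealP I) => _ [_ +] _; apply. Qed.
Let IL a x : inI x -> inI (sblambda a x).
Proof. by case: (idealP I) => _ _; apply. Qed.

Lemma coset_relP x y : reflect (inI (- x + y)) (coset_rel x y).
Proof. exact: asboolP. Qed.

Lemma coset_rel_mulP x y : reflect (inI (x^-1%g ∘ y)) (coset_rel x y).
Proof.
apply: (iffP (coset_relP _ _)) => [h|h].
  suff -> : x^-1%g ∘ y = sblambda x^-1%g (- x + y) by exact: IL.
  rewrite -[y in LHS](sbaddNKr x) [x + _](_ : _ = x ∘ sblambda x^-1%g (- x + y)).
    by rewrite mulgA mulVg mul1g.
  by rewrite sbmulE -sblambdaM mulgV sblambda1.
suff -> : - x + y = sblambda x (x^-1%g ∘ y) by exact: IL.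
by rewrite /sblambda mulgA mulgV mul1g.
Qed.

Fact coset_rel_refl : reflexive coset_rel.
Proof. by move=> x; apply/coset_relP; rewrite sbaddNr. Qed.

Fact coset_rel_sym : symmetric coset_rel.
Proof.
by move=> x y; apply/coset_relP/coset_relP => /IN; rewrite sboppD sboppK.
Qed.

Fact coset_rel_trans : transitive coset_rel.
Proof.
move=> y x z /coset_relP h1 /coset_relP h2; apply/coset_relP.
by have := ID h1 h2; rewrite -sbaddA sbaddNKr.
Qed.

Canonical coset_equiv :=
  EquivRel coset_rel coset_rel_refl coset_rel_sym coset_rel_trans.

Definition sbquot := {eq_quot coset_equiv}.
HB.instance Definition _ := Choice.on sbquot.
HB.instance Definition _ := EqQuotient.on sbquot.

Lemma sbquotP x y : \pi_sbquot x = \pi_sbquot y <-> inI (- x + y).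
Proof. by split=> [/eqmodP/coset_relP|h]; last exact/eqmodP/coset_relP. Qed.

Lemma sbquot_mulP x y : \pi_sbquot x = \pi_sbquot y <-> inI (x^-1%g ∘ y).
Proof.
by split=> [/eqmodP/coset_rel_mulP|h]; last exact/eqmodP/coset_rel_mulP.
Qed.

Definition sbq_zero := lift_cst sbquot (0 : B).
Definition sbq_one := lift_cst sbquot (1%g : B).
Definition sbq_opp := lift_op1 sbquot (fun x : B => - x).
Definition sbq_inv := lift_op1 sbquot (fun x : B => x^-1%g).
Definition sbq_add := lift_op2 sbquot (fun x y : B => x + y).
Definition sbq_mul := lift_op2 sbquot (fun x y : B => x ∘ y).

Lemma pi_sbq_zero : \pi_sbquot 0 = sbq_zero.
Proof. by rewrite /sbq_zero; unlock. Qed.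

Lemma pi_sbq_one : \pi_sbquot 1%g = sbq_one.
Proof. by rewrite /sbq_one; unlock. Qed.

Lemma pi_sbq_opp x : \pi_sbquot (- x) = sbq_opp (\pi x).
Proof.
rewrite /sbq_opp; unlock; apply/sbquotP.
have /sbquotP/IN := esym (reprK (\pi_sbquot x)).
move/IJ => /(_ (- x)); rewrite !sboppD !sboppK.
by rewrite -!sbaddA sbaddrN sbaddr0.
Qed.

Lemma pi_sbq_inv x : \pi_sbquot x^-1%g = sbq_inv (\pi x).
Proof.
rewrite /sbq_inv; unlock; apply/sbquot_mulP.
have /sbquot_mulP/IV := esym (reprK (\pi_sbquot x)).
move/IJm => /(_ x^-1%g); rewrite invgM !invgK.
by rewrite -!mulgA mulgV mulg1.
Qed.

Lemma pi_sbq_add x y : \pi_sbquot (x + y) = sbq_add (\pi x) (\pi y).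
Proof.
rewrite /sbq_add; unlock; apply/sbquotP.
have /sbquotP hx := esym (reprK (\pi_sbquot x)).
have /sbquotP hy := esym (reprK (\pi_sbquot y)).
have := ID (IJ y hx) hy.
by rewrite sboppD -!sbaddA sbaddNKr.
Qed.

Lemma pi_sbq_mul x y : \pi_sbquot (x ∘ y) = sbq_mul (\pi x) (\pi y).
Proof.
rewrite /sbq_mul; unlock; apply/sbquot_mulP.
have /sbquot_mulP hx := esym (reprK (\pi_sbquot x)).
have /sbquot_mulP hy := esym (reprK (\pi_sbquot y)).
have := IM (IJm y hx) hy.
by rewrite invgM -!mulgA mulVKg.
Qed.

Let piE :=
  (pi_sbq_zero, pi_sbq_one, pi_sbq_opp, pi_sbq_inv, pi_sbq_add, pi_sbq_mul).

Fact sbq_mulA : associative sbq_mul.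
Proof.
elim/quotW=> x; elim/quotW=> y; elim/quotW=> z.
by rewrite -!piE mulgA.
Qed.
Fact sbq_mul1r : left_id sbq_one sbq_mul.
Proof. by elim/quotW=> x; rewrite -!piE mul1g. Qed.
Fact sbq_mulr1 : right_id sbq_one sbq_mul.
Proof. by elim/quotW=> x; rewrite -!piE mulg1. Qed.
Fact sbq_mulVr : left_inverse sbq_one sbq_inv sbq_mul.
Proof. by elim/quotW=> x; rewrite -!piE mulVg. Qed.
Fact sbq_mulrV : right_inverse sbq_one sbq_inv sbq_mul.
Proof. by elim/quotW=> x; rewrite -!piE mulgV. Qed.

HB.instance Definition _ :=
  isGroup.Build sbquot sbq_mulA sbq_mul1r sbq_mulr1 sbq_mulVr sbq_mulrV.

Fact sbq_addA : associative sbq_add.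
Proof.
elim/quotW=> x; elim/quotW=> y; elim/quotW=> z.
by rewrite -!piE sbaddA.
Qed.
Fact sbq_add0r : left_id sbq_zero sbq_add.
Proof. by elim/quotW=> x; rewrite -!piE sbadd0r. Qed.
Fact sbq_addr0 : right_id sbq_zero sbq_add.
Proof. by elim/quotW=> x; rewrite -!piE sbaddr0. Qed.
Fact sbq_addNr : left_inverse sbq_zero sbq_opp sbq_add.
Proof. by elim/quotW=> x; rewrite -!piE sbaddNr. Qed.
Fact sbq_addrN : right_inverse sbq_zero sbq_opp sbq_add.
Proof. by elim/quotW=> x; rewrite -!piE sbaddrN. Qed.
Fact sbq_mulD (a b c : sbquot) :
  a ∘ sbq_add b c = sbq_add (sbq_add (a ∘ b) (sbq_opp a)) (a ∘ c).
Proof.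
elim/quotW: a => x; elim/quotW: b => y; elim/quotW: c => z.
have mulE u v : u ∘ v = sbq_mul u v by [].
by rewrite !mulE -!piE sbmulD.
Qed.

HB.instance Definition _ := isSkewBrace.Build sbquot
  sbq_addA sbq_add0r sbq_addr0 sbq_addNr sbq_addrN sbq_mulD.

Lemma pi_sb0 : \pi_sbquot 0 = 0.
Proof. exact: pi_sbq_zero. Qed.

Lemma pi_sbN x : \pi_sbquot (- x) = - \pi_sbquot x.
Proof. exact: pi_sbq_opp. Qed.

Lemma pi_sbD x y : \pi_sbquot (x + y) = \pi_sbquot x + \pi_sbquot y.
Proof. exact: pi_sbq_add. Qed.

Lemma pi_sbM x y : \pi_sbquot (x ∘ y) = \pi_sbquot x ∘ \pi_sbquot y.
Proof. exact: pi_sbq_mul. Qed.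

End Quotient.

(* Only the ideals I 0, ..., I n are constrained. *)
Definition annihilator_series (B : skewBraceType) (n : nat)
    (I : nat -> ideal B) : Prop :=
  [/\ I 0%N = [set 0] :> set B,
      I n = [set: B] :> set B &
      forall j, (j < n)%N ->
        I j `<=` I j.+1 /\
        [set \pi_(sbquot (I j)) x | x in I j.+1] `<=` Ann (sbquot (I j))].

Definition annihilator_nilpotent (B : skewBraceType) : Prop :=
  exists n (I : nat -> ideal B), annihilator_series n I.

(* Main.v *)
Require Import Defs.
From mathcomp Require Import all_boot.
From mathcomp Require Import boolp classical_sets.

Set Implicit Arguments.
Unset Strict Implicit.
Unset Printing Implicit Defensive.

Local Open Scope classical_set_scope.
Local Open Scope quotient_scope.
Local Open Scope skew_brace_scope.

(** The star operation only sees its arguments modulo the annihilator. Hence, if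
    A + I(j+1) = B, every product x ⋆ y agrees modulo I(j) with some a ⋆ b, where
    a and b lie in A; so B^2 is contained in A + I(j), and A + B^2 = B forces
    A + I(j) = B. Descending along the annihilator series gives A + 0 = B. *)

Section StarAnnihilator.
Variable B : skewBraceType.
Implicit Types a b z : B.

Lemma Ann_mulr a z : Ann B z -> a ∘ z = a + z.
Proof. by move=> /(_ a)[_ -> ->]. Qed.

Lemma Ann_mull a z : Ann B z -> z ∘ a = z + a.
Proof. by move=> /(_ a)[-> -> _]. Qed.

(** Since a + z = z ∘ a, the product (a + z) ∘ b equals z + a ∘ b, and this z cancels against the
    one in - (z + a). *)
Lemma star_addAnnl a b z : Ann B z -> (a + z) ⋆ b = a ⋆ b.
Proof.
move=> hz; have [_ _ <-] := hz a.
rewrite /sbstar -[in X in _ + X - _](Ann_mull a hz) -mulgA (Ann_mull _ hz).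
by rewrite (sboppD z a) -(sbaddA (- a)) sbaddKr.
Qed.

(** Here a ∘ (b + z) = a ∘ b ∘ z = a ∘ b + z, and z cancels against - (b + z). *)
Lemma star_addAnnr a b z : Ann B z -> a ⋆ (b + z) = a ⋆ b.
Proof.
move=> hz; rewrite /sbstar -[in X in _ + X - _](Ann_mulr b hz) mulgA (Ann_mulr _ hz).
by rewrite (sboppD b z) -!sbaddA sbaddNKr.
Qed.

End StarAnnihilator.

Lemma sub_skew_brace_star (B : skewBraceType) (A : set B) a b :
  sub_skew_brace A -> A a -> A b -> A (a ⋆ b).
Proof.
by move=> [[_ AD AN] [_ AM _]] Aa Ab; apply: (AD); [apply: (AD)|]; auto.
Qed.

Section AddIdeal.
Variables (B : skewBraceType) (I : ideal B) (A : set B).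

Lemma pi_sbstar x y :
  \pi_(sbquot I) (x ⋆ y) = \pi_(sbquot I) x ⋆ \pi_(sbquot I) y.
Proof. by rewrite /sbstar !pi_sbD !pi_sbN pi_sbM. Qed.

(** This is A + I, phrased in the quotient so that additive closure follows from [\pi] being a
    homomorphism. *)
Definition add_ideal : set B :=
  [set x | exists2 a, A a & \pi_(sbquot I) x = \pi_(sbquot I) a].

Lemma add_ideal_subgroup : add_subgroup A -> add_subgroup add_ideal.
Proof.
move=> [A0 AD AN]; split; first by exists 0.
- move=> x y [a Aa xa] [b Ab yb].
  by exists (a + b); [exact: AD | rewrite !pi_sbD xa yb].
- by move=> x [a Aa xa]; exists (- a); [exact: AN | rewrite !pi_sbN xa].
Qed.

Lemma sqr_brace_add_ideal (J : ideal B) (hA : sub_skew_brace A) :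
  [set \pi_(sbquot I) x | x in J] `<=` Ann (sbquot I) ->
  (forall x, exists2 a, A a & ideal_set J (- a + x)) ->
  sqr_brace B `<=` add_ideal.
Proof.
move=> hJ hAJ; apply: smallest_sub; first by apply: add_ideal_subgroup; case: hA.
move=> _ [x _ [y _ <-]].
have [a Aa Jx] := hAJ x; have [b Ab Jy] := hAJ y.
exists (a ⋆ b); first exact: sub_skew_brace_star.
(* The corrections - a + x and - b + y lie in J, so their images in B / I are in the annihilator. *)
rewrite -(sbaddNKr a x) -(sbaddNKr b y) !pi_sbstar.
rewrite (pi_sbD _ a) (pi_sbD _ b).
rewrite star_addAnnl ?star_addAnnr //; apply: hJ.
  by exists (- b + y).
by exists (- a + x).
Qed.

End AddIdeal.

Theorem theorem5p2 (B : skewBraceType) (hB : annihilator_nilpotent B)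
  (A : set B) (hA : sub_skew_brace A)
  (hAB : add_set A (sqr_brace B) = [set: B]%classic) :
  A = [set: B]%classic.
Proof.
have [n [I [I0 In hI]]] := hB.
have [[_ AD _] _] := hA.
(* The induction goes down the series, from I n = B at k = 0 to I 0 = 0 at k = n. *)
have AI k : (k <= n)%N -> forall x, exists2 a, A a & ideal_set (I (n - k)%N) (- a + x).
  elim: k => [_ x|k IH ltkn x].
    by rewrite subn0 In; have [[A0 _ _] _] := hA; exists 0.
  have ltj : (n - k.+1 < n)%N by rewrite ltn_subrL (leq_ltn_trans _ ltkn).
  have [_ hann] := hI _ ltj.
  (* With j = n - k.+1, the index n - k becomes j.+1, as [hann] requires. *)
  have /IH AJ := ltnW ltkn; rewrite -subnSK // in AJ.
  have sqrA := sqr_brace_add_ideal hA hann AJ.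
  have : add_set A (sqr_brace B) x by rewrite hAB.
  move=> [a Aa [s /sqrA[b Ab sb] <-]].
  (* x = a + s with s congruent to b modulo I j, hence x is congruent to a + b. *)
  exists (a + b); first exact: AD.
  by apply/sbquotP; rewrite !pi_sbD sb.
apply/seteqP; split=> // x _.
have [a Aa] := AI n (leqnn n) x; rewrite subnn I0 => e.
by rewrite -(sbaddNKr a x) e sbaddr0.
Qed.
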